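(* Let $(V,\mathcal{Y},c)$ be a graded vertex coalgebra, let $v'\in(V^{\otimes3})'$ and $v\in V$. (a) (Left rationality) The formal series $\langle v',(\mathcal{Y}(x_0)\otimes Id_V)\mathcal{Y}(x_2)v\rangle$ is in $\mathbb{F}[x_0^{-1},x_2][[x_0,x_2^{-1}]]$ and in fact $$\langle v',(\mathcal{Y}(x_0)\otimes Id_V)\mathcal{Y}(x_2)v\rangle=\iota_{20}k(x_0,x_2)$$ where $k(x_0,x_2)\in\mathbb{F}[x_0,x_2]_S$ is uniquely determined and is of the form $$k(x_0,x_2)=\frac{h(x_0,x_2)}{x_0^rx_2^s(x_0+x_2)^t}$$ for some $h(x_0,x_2)\in\mathbb{F}[x_0,x_2]$ and $r,s,t\in\mathbb{Z}$. (b) (Coassociativity) It is also the case that $$\iota_{12}^{-1}\langle v',(Id_V\otimes\mathcal{Y}(x_2))\mathcal{Y}(x_1)v\rangle=\left.\left(\iota_{20}^{-1}\langle v',(\mathcal{Y}(x_0)\otimes Id_V)\mathcal{Y}(x_2)v\rangle\right)\right|_{x_0=x_1-x_2}.$$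
   Context: All vector spaces are over a field $\mathbb{F}$ of characteristic $0$; $x,x_0,x_1,x_2$ are commuting formal variables. $\delta(x)=\sum_{n\in\mathbb{Z}}x^n$. For $n\in\mathbb{Z}$, $(x_i\pm x_j)^n$ as a formal series is expanded in nonnegative integral powers of the second listed variable $x_j$ (this also applies inside $\delta$). $W[[x,x^{-1}]]$ is the space of all doubly infinite formal series with coefficients in $W$, and $W((x^{-1}))$ is the space of those with only finitely many positive powers of $x$. $T(u\otimes v)=v\otimes u$ on $V\otimes V$. Linear maps and pairings act on formal series coefficientwise. A vertex coalgebra $(V,\mathcal{Y},c)$ is a vector space $V$ with linear maps $\mathcal{Y}(x):V\to(V\otimes V)[[x,x^{-1}]]$ and $c:V\to\mathbb{F}$ such that for all $v\in V$: 1. Left counit: $(c\otimes Id_V)\mathcal{Y}(x)v=v$. 2. Cocreation: $(Id_V\otimes c)\mathcal{Y}(x)v\in V[[x]]$ and $\lim_{x\to0}(Id_V\otimes c)\mathcal{Y}(x)v=v$. 3. Truncation: $\mathcal{Y}(x)v\in(V\otimes V)((x^{-1}))$. 4. Jacobi identity: $$x_0^{-1}\delta\left(\tfrac{x_1-x_2}{x_0}\right)(Id_V\otimes\mathcal{Y}(x_2))\mathcal{Y}(x_1)-x_0^{-1}\delta\left(\tfrac{x_2-x_1}{-x_0}\right)(T\otimes Id_V)(Id_V\otimes\mathcal{Y}(x_1))\mathcal{Y}(x_2)=x_2^{-1}\delta\left(\tfrac{x_1-x_0}{x_2}\right)(\mathcal{Y}(x_0)\otimes Id_V)\mathcal{Y}(x_2).$$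 It is a graded vertex coalgebra if $V=\coprod_{k\in\mathbb{Z}}V_{(k)}$ is $\mathbb{Z}$-graded with $V_{(k)}=0$ for $k$ sufficiently negative and, writing $\mathcal{Y}(x)v=\sum_{k\in\mathbb{Z}}\Delta_k(v)x^{-k-1}$, one has $\Delta_k(v)\in(V\otimes V)_{(r+k+1)}$ for all $v\in V_{(r)}$ and $r,k\in\mathbb{Z}$. For a graded space $W=\coprod_k W_{(k)}$, the graded dual is $W'=\coprod_k \mathrm{Hom}(W_{(k)},\mathbb{F})$, and $\langle\cdot,\cdot\rangle$ is the natural pairing of $W'$ with $W$. $V^{\otimes n}$ is graded by total weight, and $(V^{\otimes n})'$ is its graded dual. For two variables $x_i,x_j$, $\mathbb{F}[x_i,x_j]_S$ is the ring of rational functions obtained from $\mathbb{F}[x_i,x_j]$ by inverting products of nonzero homogeneous linear polynomials in $x_i,x_j$. The injective map $\iota_{ij}:\mathbb{F}[x_i,x_j]_S\to\mathbb{F}[[x_i,x_i^{-1},x_j,x_j^{-1}]]$ expands a rational function by expanding negative powers of $x_i\pm x_j$ in nonnegative powers of $x_j$ (powers of $x_i$ and $x_j$ themselves being left unchanged). Thus $\iota_{12}$ expands $(x_1-x_2)^{-t}$ in nonnegative powers of $x_2$, and $\iota_{20}$ expands $(x_0+x_2)^{-t}$ in nonnegative powers of $x_0$. $\iota_{ij}^{-1}$ is the inverse on the image. The substitution $x_0=x_1-x_2$ is made in the rational function. *)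

(* Defs.v *)
From HB Require Import structures.
From mathcomp Require Import all_boot all_order all_algebra.
From mathcomp Require Import generic_quotient fraction polyXY sesquilinear.
From mathcomp Require Import boolp classical_sets functions cardinality fsbigop.
From mathcomp Require Import ring lra zify.

Set Implicit Arguments.
Unset Strict Implicit.
Unset Printing Implicit Defensive.

Import Order.TTheory GRing.Theory Num.Theory.
Local Open Scope ring_scope.
Local Open Scope quotient_scope.

Notation "p %:F" := (FracField.tofrac p) : ring_scope.

Section Tensor.
Variables (F : fieldType) (U V : lmodType F).

(* MathComp has no tensor product of arbitrary vector spaces.  A list
   [:: (u1, v1); ...; (un, vn)] stands for the formal sum of the ui (x) vi;
   scalars are not needed, since a (u (x) v) = (a u) (x) v.  The universal
   property is given by tensor_lift, tensor_lift_pure and tensor_lift_uniq. *)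
Inductive tensor_cong : seq (U * V) -> seq (U * V) -> Prop :=
| TensorRefl s : tensor_cong s s
| TensorSym s t : tensor_cong s t -> tensor_cong t s
| TensorTrans s t r : tensor_cong s t -> tensor_cong t r -> tensor_cong s r
| TensorCat s s' t t' :
    tensor_cong s s' -> tensor_cong t t' -> tensor_cong (s ++ t) (s' ++ t')
| TensorC s t : tensor_cong (s ++ t) (t ++ s)
| TensorDl u u' v : tensor_cong [:: (u + u', v)] [:: (u, v); (u', v)]
| TensorDr u v v' : tensor_cong [:: (u, v + v')] [:: (u, v); (u, v')]
| TensorZ a u v : tensor_cong [:: (a *: u, v)] [:: (u, a *: v)]
| Tensor0 v : tensor_cong [:: (0, v)] [::].

Definition tensor_equiv s t := `[< tensor_cong s t >].

Lemma tensor_equiv_refl : reflexive tensor_equiv.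
Proof. by move=> s; apply/asboolP/TensorRefl. Qed.

Lemma tensor_equiv_sym : symmetric tensor_equiv.
Proof.
by move=> s t; apply/idP/idP => /asboolP h; apply/asboolP/TensorSym.
Qed.

Lemma tensor_equiv_trans : transitive tensor_equiv.
Proof.
by move=> t s r /asboolP h /asboolP k; apply/asboolP/(TensorTrans h k).
Qed.

Canonical tensor_equiv_rel :=
  EquivRel tensor_equiv tensor_equiv_refl tensor_equiv_sym tensor_equiv_trans.

Definition tensor := {eq_quot tensor_equiv}.
HB.instance Definition _ : EqQuotient _ tensor_equiv tensor :=
  EqQuotient.on tensor.
HB.instance Definition _ := Choice.on tensor.

Lemma tensor_piP s t : \pi_tensor s = \pi_tensor t <-> tensor_cong s t.
Proof.
have e : (s == t %[mod tensor]) = tensor_equiv s t by rewrite eqmodE.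
split=> h; last by apply/eqP; rewrite e; apply/asboolP.
suff /asboolP : tensor_equiv s t by [].
by rewrite -e h.
Qed.

Lemma tensor_eqP s t : tensor_cong s t -> \pi_tensor s = \pi_tensor t.
Proof. by move=> /tensor_piP. Qed.

Lemma tensor_reprP s : tensor_cong (repr (\pi_tensor s)) s.
Proof. by apply/tensor_piP; rewrite reprK. Qed.

Lemma tensor_piE (x : tensor) : exists s, x = \pi_tensor s.
Proof. by exists (repr x); rewrite reprK. Qed.

Definition tensor_zero : tensor := \pi_tensor [::].
Definition tensor_add (x y : tensor) : tensor := \pi_tensor (repr x ++ repr y).
Definition tensor_scale (a : F) (x : tensor) : tensor :=
  \pi_tensor [seq (a *: p.1, p.2) | p <- repr x].
Definition tensor_opp := tensor_scale (-1).

Lemma tensor_add_pi s t :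
  tensor_add (\pi_tensor s) (\pi_tensor t) = \pi_tensor (s ++ t).
Proof. by apply: tensor_eqP; apply: TensorCat; apply: tensor_reprP. Qed.

Lemma tensor_cong_scale a s t : tensor_cong s t ->
  tensor_cong [seq (a *: p.1, p.2) | p <- s] [seq (a *: p.1, p.2) | p <- t].
Proof.
elim => {s t}.
- by move=> s; apply: TensorRefl.
- by move=> s t _; apply: TensorSym.
- by move=> s t r _ h _; apply: TensorTrans.
- by move=> s s' t t' _ h _ k; rewrite !map_cat; apply: TensorCat.
- by move=> s t; rewrite !map_cat; apply: TensorC.
- by move=> u u' v /=; rewrite scalerDr; apply: TensorDl.
- by move=> u v v'; apply: TensorDr.
- by move=> b u v /=; rewrite scalerA mulrC -scalerA; apply: TensorZ.
- by move=> v /=; rewrite scaler0; apply: Tensor0.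
Qed.

Lemma tensor_scale_pi a s :
  tensor_scale a (\pi_tensor s) = \pi_tensor [seq (a *: p.1, p.2) | p <- s].
Proof. by apply: tensor_eqP; apply/tensor_cong_scale/tensor_reprP. Qed.

Lemma tensor_addA : associative tensor_add.
Proof.
move=> x y z.
have [s ->] := tensor_piE x; have [t ->] := tensor_piE y.
have [r ->] := tensor_piE z.
rewrite (tensor_add_pi t r) (tensor_add_pi s t).
by rewrite (tensor_add_pi s) (tensor_add_pi _ r) catA.
Qed.

Lemma tensor_addC : commutative tensor_add.
Proof.
move=> x y; have [s ->] := tensor_piE x; have [t ->] := tensor_piE y.
by rewrite (tensor_add_pi s t) (tensor_add_pi t s); apply/tensor_eqP/TensorC.
Qed.

Lemma tensor_add0 : left_id tensor_zero tensor_add.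
Proof.
by move=> x; have [s ->] := tensor_piE x; rewrite (tensor_add_pi [::] s).
Qed.

Lemma tensor_scaleDl x a b :
  tensor_scale (a + b) x = tensor_add (tensor_scale a x) (tensor_scale b x).
Proof.
have [s ->] := tensor_piE x.
rewrite (tensor_scale_pi a s) (tensor_scale_pi b s) tensor_scale_pi.
rewrite tensor_add_pi; apply: tensor_eqP.
elim: s => [|p s IH] /=; first exact: TensorRefl.
rewrite scalerDl.
apply: TensorTrans (TensorCat (TensorDl _ _ _) IH) _.
rewrite -cat1s -catA -[X in tensor_cong _ X]cat1s.
apply: TensorCat; first exact: TensorRefl.
set A := map _ _; set B := map _ _.
rewrite catA -[_ :: B]cat1s catA.
by apply: TensorCat; [apply: TensorC | apply: TensorRefl].
Qed.

Lemma tensor_scale0 x : tensor_scale 0 x = tensor_zero.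
Proof.
have [t ->] := tensor_piE x.
rewrite tensor_scale_pi; apply: tensor_eqP.
elim: t => [|p s IH] /=; first exact: TensorRefl.
by rewrite scale0r; apply: (TensorCat (Tensor0 _) IH).
Qed.

Lemma tensor_scale1 : left_id 1 tensor_scale.
Proof.
move=> x; have [s ->] := tensor_piE x; rewrite tensor_scale_pi; congr \pi_tensor.
by rewrite -[RHS]map_id; apply: eq_map => -[u v] /=; rewrite scale1r.
Qed.

Lemma tensor_addN : left_inverse tensor_zero tensor_opp tensor_add.
Proof.
move=> x; rewrite -{2}[x]tensor_scale1 -tensor_scaleDl addNr.
exact: tensor_scale0.
Qed.

HB.instance Definition _ :=
  GRing.isZmodule.Build tensor tensor_addA tensor_addC tensor_add0 tensor_addN.

Lemma tensor_scaleA a b x :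
  tensor_scale a (tensor_scale b x) = tensor_scale (a * b) x.
Proof.
have [s ->] := tensor_piE x; rewrite !tensor_scale_pi -map_comp; congr \pi_tensor.
by apply: eq_map => p /=; rewrite scalerA.
Qed.

Lemma tensor_scaleDr : right_distributive tensor_scale +%R.
Proof.
move=> a x y; have [s ->] := tensor_piE x; have [t ->] := tensor_piE y.
rewrite [\pi_tensor s + _](tensor_add_pi s t) (tensor_scale_pi a s).
rewrite (tensor_scale_pi a t) tensor_scale_pi map_cat.
by rewrite [RHS]tensor_add_pi.
Qed.

HB.instance Definition _ :=
  GRing.Zmodule_isLmodule.Build F tensor
    tensor_scaleA tensor_scale1 tensor_scaleDr tensor_scaleDl.

Definition tpure (u : U) (v : V) : tensor := \pi_tensor [:: (u, v)].

Lemma tpureDl u u' v : tpure (u + u') v = tpure u v + tpure u' v.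
Proof. by rewrite [RHS]tensor_add_pi; apply/tensor_eqP/TensorDl. Qed.

Lemma tpureDr u v v' : tpure u (v + v') = tpure u v + tpure u v'.
Proof. by rewrite [RHS]tensor_add_pi; apply/tensor_eqP/TensorDr. Qed.

Fact tpure_zmod_morphisml v : zmod_morphism (tpure ^~ v).
Proof. by move=> u u'; apply/(addIr (tpure u' v)); rewrite -tpureDl !subrK. Qed.

Fact tpure_zmod_morphismr u : zmod_morphism (tpure u).
Proof. by move=> v v'; apply/(addIr (tpure u v')); rewrite -tpureDr !subrK. Qed.

Fact tpure_scalel v : scalable (tpure ^~ v).
Proof. by move=> a u; rewrite [RHS]tensor_scale_pi. Qed.

Fact tpure_scaler u : scalable (tpure u).
Proof.
move=> a v; rewrite [RHS]tensor_scale_pi /=.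
by apply/tensor_eqP/TensorSym/TensorZ.
Qed.

HB.instance Definition _ :=
  isBilinear.Build F U V tensor *:%R *:%R tpure
    tpure_zmod_morphisml tpure_zmod_morphismr tpure_scalel tpure_scaler.

Lemma tensor_pi_sum s : \pi_tensor s = \sum_(p <- s) tpure p.1 p.2.
Proof.
elim: s => [|[u v] s IH]; first by rewrite big_nil.
by rewrite big_cons -IH [RHS]tensor_add_pi.
Qed.

Lemma tensor_reprE (x : tensor) : x = \sum_(p <- repr x) tpure p.1 p.2.
Proof. by rewrite -tensor_pi_sum reprK. Qed.

Section Lift.
Variables (W : lmodType F) (f : {bilinear U -> V -> W}).

Definition tensor_lift (x : tensor) : W := \sum_(p <- repr x) f p.1 p.2.

Lemma tensor_cong_lift s t : tensor_cong s t ->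
  \sum_(p <- s) f p.1 p.2 = \sum_(p <- t) f p.1 p.2.
Proof.
elim => {s t}.
- by [].
- by move=> s t _ ->.
- by move=> s t r _ -> _ ->.
- by move=> s s' t t' _ h _ k; rewrite !big_cat /= h k.
- by move=> s t; rewrite !big_cat /= addrC.
- by move=> u u' v; rewrite !big_cons !big_nil !addr0 linearDl.
- by move=> u v v'; rewrite !big_cons !big_nil !addr0 linearDr.
- by move=> a u v; rewrite !big_seq1 /= linearZl_LR linearZr_LR.
- by move=> v; rewrite big_seq1 big_nil linear0l.
Qed.

Lemma tensor_lift_pi s : tensor_lift (\pi_tensor s) = \sum_(p <- s) f p.1 p.2.
Proof. exact/tensor_cong_lift/tensor_reprP. Qed.

Lemma tensor_lift_pure u v : tensor_lift (tpure u v) = f u v.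
Proof. by rewrite tensor_lift_pi big_seq1. Qed.

Fact tensor_lift_is_linear : linear tensor_lift.
Proof.
move=> a x y; have [s ->] := tensor_piE x; have [t ->] := tensor_piE y.
rewrite [a *: _]tensor_scale_pi [_ + \pi_tensor t]tensor_add_pi !tensor_lift_pi.
rewrite big_cat big_map /= scaler_sumr; congr (_ + _).
by apply: eq_bigr => p _; rewrite linearZl_LR.
Qed.

HB.instance Definition _ :=
  GRing.isLinear.Build F tensor W _ tensor_lift tensor_lift_is_linear.

End Lift.

Lemma tensor_lift_uniq (W : lmodType F) (g h : {linear tensor -> W}) :
  (forall u v, g (tpure u v) = h (tpure u v)) -> g =1 h.
Proof.
move=> gh x; rewrite [x]tensor_reprE !linear_sum.
by apply: eq_bigr => p _; apply: gh.
Qed.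

End Tensor.

Notation "u '\ot' v" := (tpure u v) (at level 40, left associativity).

Section TensorMaps.
Variable F : fieldType.

Section Map.
Variables (U U' V V' : lmodType F) (f : {linear U -> U'}) (g : {linear V -> V'}).

Definition tmap0 (u : U) (v : V) : tensor U' V' := f u \ot g v.

Fact tmap0_bilinear : bilinear_for *:%R *:%R tmap0.
Proof.
split=> [v a u u'|u a v v']; rewrite /tmap0 /= linearP.
  by rewrite linearPl.
by rewrite linearPr.
Qed.

HB.instance Definition _ :=
  bilinear_isBilinear.Build F U V (tensor U' V') *:%R *:%R tmap0 tmap0_bilinear.

Definition tmap : {linear tensor U V -> tensor U' V'} := tensor_lift tmap0.

Lemma tmapE u v : tmap (u \ot v) = f u \ot g v.
Proof. exact: tensor_lift_pure. Qed.
End Map.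

Section Twist.
Variables (U V : lmodType F).

Definition twist0 (u : U) (v : V) : tensor V U := v \ot u.

Fact twist0_bilinear : bilinear_for *:%R *:%R twist0.
Proof. by split=> [v a u u'|u a v v']; rewrite /twist0 /= ?linearPr ?linearPl. Qed.

HB.instance Definition _ :=
  bilinear_isBilinear.Build F U V (tensor V U) *:%R *:%R twist0 twist0_bilinear.

Definition twist : {linear tensor U V -> tensor V U} := tensor_lift twist0.

Lemma twistE u v : twist (u \ot v) = v \ot u.
Proof. exact: tensor_lift_pure. Qed.
End Twist.

Section Contract.
Variables (U V : lmodType F).

Definition contractl0 (c : {scalar U}) (u : U) (v : V) : V := c u *: v.

Fact contractl0_bilinear c : bilinear_for *:%R *:%R (contractl0 c).
Proof.
split=> [v a u u'|u a v v']; rewrite /contractl0 /=.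
  by rewrite linearP scalerDl scalerA.
by rewrite scalerDr !scalerA mulrC.
Qed.

HB.instance Definition _ c :=
  bilinear_isBilinear.Build F U V V *:%R *:%R (contractl0 c)
    (contractl0_bilinear c).

Definition contractl c : {linear tensor U V -> V} := tensor_lift (contractl0 c).

Lemma contractlE c u v : contractl c (u \ot v) = c u *: v.
Proof. exact: tensor_lift_pure. Qed.

Definition contractr c : {linear tensor V U -> V} := contractl c \o @twist V U.

Lemma contractrE c v u : contractr c (v \ot u) = c u *: v.
Proof. by rewrite /contractr /= twistE contractlE. Qed.
End Contract.

Section Assoc.
Variables (U V W : lmodType F).

Definition tassoc1 (u : U) (v : V) (w : W) : tensor (tensor U V) W :=
  (u \ot v) \ot w.

Fact tassoc1_bilinear u : bilinear_for *:%R *:%R (tassoc1 u).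
Proof.
split=> [w a v v'|v a w w']; rewrite /tassoc1 /=.
  by rewrite linearPr linearPl.
by rewrite linearPr.
Qed.

HB.instance Definition _ u :=
  bilinear_isBilinear.Build F V W (tensor (tensor U V) W) *:%R *:%R
    (tassoc1 u) (tassoc1_bilinear u).

Definition tassoc0 (u : U) (t : tensor V W) : tensor (tensor U V) W :=
  tensor_lift (tassoc1 u) t.

Fact tassoc0_bilinear : bilinear_for *:%R *:%R tassoc0.
Proof.
split=> [t a u u'|u a t t'] /=; last exact: linearP.
have [s ->] := tensor_piE t; rewrite /tassoc0 !tensor_lift_pi.
rewrite scaler_sumr -big_split /=; apply: eq_bigr => p _.
by rewrite /tassoc1 !linearPl.
Qed.

HB.instance Definition _ :=
  bilinear_isBilinear.Build F U (tensor V W) (tensor (tensor U V) W) *:%R *:%R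
    tassoc0 tassoc0_bilinear.

Definition tassoc : {linear tensor U (tensor V W) -> tensor (tensor U V) W} :=
  tensor_lift tassoc0.

Lemma tassocE u v w : tassoc (u \ot (v \ot w)) = (u \ot v) \ot w.
Proof. by apply: etrans (tensor_lift_pure _ _ _) _; apply: tensor_lift_pure. Qed.
End Assoc.

End TensorMaps.

Section Series.
Variable F : fieldType.

(* A formal series with coefficients in W is the function sending an exponent
   (in int for x, in int * int for two variables, in int * int * int for x0, x1,
   x2) to its coefficient.  smul is the product of a scalar series by a
   W-valued one; an infinite sum would give 0, but in the products below all
   sums are finite (by truncation, in the case of the Jacobi identity). *)
Definition smul (G : zmodType) (W : lmodType F) (f : G -> F) (A : G -> W)
    : G -> W :=
  fun g => \sum_(p \in [set: G]) f p *: A (g - p).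

(* n (n - 1) ... (n - k + 1) / k! *)
Definition bincoef (n : int) (k : nat) : F :=
  (\prod_(j < k) (n%:~R - j%:R)) / (k`!)%:R.

(* (x + s y)^n expanded in nonnegative powers of y; q = (exponent of x,
   exponent of y). *)
Definition binpow (s : F) (n : int) (q : int * int) : F :=
  match q.2 with
  | Posz k => if q.1 == n - k%:Z then bincoef n k * s ^+ k else 0
  | Negz _ => 0
  end.
End Series.

Section Fraction.
Variable R : idomainType.
Implicit Types p q a b : R.

Lemma frac_eqP p q a b : a != 0 -> b != 0 ->
  p%:F / a%:F = q%:F / b%:F <-> p * b = q * a.
Proof.
move=> a0 b0; have aF : a%:F != 0 by rewrite tofrac_eq0.
have bF : b%:F != 0 by rewrite tofrac_eq0.
have E : (p%:F / a%:F == q%:F / b%:F) = (p * b == q * a).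
  by rewrite eqr_div // -!tofracM tofrac_eq.
split=> [/eqP|e]; first by rewrite E => /eqP.
by apply/eqP; rewrite E e.
Qed.

Lemma fracE (x : {fraction R}) : x = (\n_(repr x))%:F / (\d_(repr x))%:F.
Proof.
rewrite -{1}[x]reprK; move: (repr x) => r.
have drF : (\d_r)%:F != 0 by rewrite tofrac_eq0 denom_ratioP.
apply: (mulIf drF); rewrite divfK // [LHS]piE [RHS]piE.
apply/eqP; rewrite FracField.equivf_def /FracField.mulf.
by rewrite !numden_Ratio ?mulf_neq0 ?oner_eq0 ?denom_ratioP ?mulr1 // mulrC.
Qed.
End Fraction.

Section Rational.
Variable F : fieldType.

(* In F[xi, xj], xi is 'X and xj is 'Y = 'X%:P, so p`_m`_n is the coefficient
   of xi^m xj^n.  The order of the pair (i, j) matters: for iota_20 the first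
   variable 'X is x2 and the second variable 'Y is x0. *)
Local Notation polyF2 := {poly {poly F}}.
Local Notation ratF2 := {fraction {poly {poly F}}}.

(* l stands for the linear polynomial l.1 xi + l.2 xj. *)
Definition linform (l : F * F) : polyF2 := l.1%:P%:P * 'X + l.2%:P%:P * 'Y.

(* F[xi, xj]_S inside the field of fractions. *)
Definition ratS : set ratF2 :=
  [set f | exists p (ls : seq (F * F)),
     (0, 0) \notin ls /\ f = p%:F / (\prod_(l <- ls) linform l)%:F].

Definition poly_series (p : polyF2) (q : int * int) : F :=
  match q.1, q.2 with Posz m, Posz n => p`_m`_n | _, _ => 0 end.

(* (a xi + b xj)^-1 = a^-1 (xi + (b / a) xj)^-1 in nonnegative powers of xj,
   and (b xj)^-1 = b^-1 xj^-1. *)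
Definition linform_inv (l : F * F) (q : int * int) : F :=
  if l.1 == 0 then (if q == (0, -1) then l.2^-1 else 0)
  else l.1^-1 * binpow (l.2 / l.1) (-1) q.

Definition expand (p : polyF2) (ls : seq (F * F)) : int * int -> F :=
  foldr (fun l (A : int * int -> F^o) => smul (linform_inv l) A)
    (poly_series p) ls.

(* Independence of the choice of p and ls is iota_ijE; the value outside
   F[xi, xj]_S is irrelevant. *)
Definition iota_ij (f : ratF2) : int * int -> F :=
  xget (fun=> 0) [set A | exists p (ls : seq (F * F)),
    [/\ (0, 0) \notin ls, f = p%:F / (\prod_(l <- ls) linform l)%:F &
        A = expand p ls]].

Hypothesis charF0 : [pchar F] =i pred0.

Lemma bincoefN1 k : bincoef F (-1) k = (-1) ^+ k.
Proof.
rewrite /bincoef; have fk : (k`!)%:R != 0 :> F.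
  by rewrite (pcharf0P F).1 // -lt0n fact_gt0.
apply/(mulIf fk); rewrite divfK // {fk}.
elim: k => [|k IH]; first by rewrite big_ord0 mulr1 expr0.
rewrite big_ord_recr /= IH factS natrM exprS -addn1 natrD mulrNz /=; ring.
Qed.

(* Multiplication of a series by a linear polynomial. *)
Definition lact (l : F * F) (A : int * int -> F) : int * int -> F :=
  fun q => l.1 * A (q.1 - 1, q.2) + l.2 * A (q.1, q.2 - 1).

(* The exponents of xj are bounded below. *)
Definition bnd (A : int * int -> F) : Prop :=
  exists B : int, forall m n : int, n < B -> A (m, n) = 0.

Lemma smul_invE (l : F * F) (A : int * int -> F) (B m n : int) (K : nat) : l.1 != 0 ->
  (forall m n : int, n < B -> A (m, n) = 0) -> n - K%:Z < B ->
  smul (linform_inv l) (A : _ -> F^o) (m, n) =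
  \sum_(k < K) l.1^-1 * (- (l.2 / l.1)) ^+ k * A (m + 1 + k%:Z, n - k%:Z).
Proof.
move=> l1 AB nK; rewrite /smul /linform_inv (negbTE l1).
rewrite (fsbigE [seq (-1 - k%:Z, k%:Z) | k <- seq.iota 0 K]) //=; last first.
- move=> [p q] _ /mapP pq /=.
  rewrite /binpow /=; case: q pq => [k|k]; last by rewrite mulr0 scale0r.
  case: eqP => [->|_]; last by rewrite mulr0 scale0r.
  move=> pq; rewrite AB ?scaler0 //.
  have : (K <= k)%N.
    by rewrite leqNgt; apply/negP => kK; apply: pq; exists k => //; rewrite mem_iota.
  by move=> Kk; apply: le_lt_trans nK; rewrite /= lerD2l lerN2 lez_nat.
- by rewrite map_inj_uniq ?iota_uniq // => i j [].
rewrite big_map (eq_bigl xpredT) => [|i]; last by rewrite in_setT.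
rewrite -[K in LHS]subn0 big_mkord; apply: eq_bigr => k _.
rewrite /binpow /= eqxx bincoefN1 [LHS]/GRing.scale /=.
rewrite -exprMn mulN1r; congr (_ * A (_, _)); rewrite /=.
by rewrite -addrA; congr (_ + _); lia.
Qed.

Lemma smul_invE0 (b : F) (A : int * int -> F) (m n : int) :
  smul (linform_inv (0, b)) (A : _ -> F^o) (m, n) = b^-1 * A (m, n + 1).
Proof.
rewrite /smul /linform_inv /= eqxx.
rewrite (fsbigE [:: (0, -1)]) //=; last first.
  by move=> q _; rewrite inE => /negbTE ->; rewrite scale0r.
rewrite big_mkcond big_seq1 in_setT eqxx [LHS]/GRing.scale /=.
by congr (_ * A (_, _)); rewrite /= ?subr0 ?opprK.
Qed.

Lemma bnd_smul l A : l != (0, 0) -> bnd A ->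
  bnd (smul (linform_inv l) (A : _ -> F^o)).
Proof.
case: l => a b; case: (eqVneq a 0) => [-> _ [B AB]|a0 _ [B AB]].
  by exists (B - 1) => m n nB; rewrite smul_invE0 AB ?mulr0 //; lia.
exists B => m n nB; rewrite (@smul_invE (a, b) A B m n 0) ?subr0 //.
by rewrite big_ord0.
Qed.

Lemma lact_smul l A : l != (0, 0) -> bnd A ->
  lact l (smul (linform_inv l) (A : _ -> F^o)) = A.
Proof.
case: l => a b; case: (eqVneq a 0) => [-> b0 [B AB]|a0 _ [B AB]].
  apply/funext => -[m n]; rewrite /lact /= mul0r add0r smul_invE0 mulVKf ?subrK //.
  by apply: contraNneq b0 => ->.
apply/funext => -[] /= m n; rewrite /lact /=.
pose K := `|n - B|%N.+1.
have nK : n - K.+1%:Z < B by rewrite /K; lia.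
have nK' : n - 1 - K%:Z < B by rewrite /K; lia.
rewrite (smul_invE _ _ AB nK) // (smul_invE _ _ AB nK') //.
rewrite big_ord_recl /= expr0 mulr1 mulrDr mulrA mulfV // mul1r subrK subr0 addr0.
rewrite -[RHS]addr0 -addrA; congr (_ + _).
rewrite !mulr_sumr -big_split big1 //= => i _.
rewrite /bump leq0n add1n.
set X := A _; set Y := A _.
have -> : X = Y by congr (A (_, _)); lia.
by rewrite exprS; field.
Qed.

Lemma lactC l l' A : lact l (lact l' A) = lact l' (lact l A).
Proof. by apply/funext => q; rewrite /lact /=; ring. Qed.

Lemma lact_inj l A A' : l != (0, 0) -> bnd A -> bnd A' ->
  lact l A = lact l A' -> A = A'.
Proof.
move=> l0 [B AB] [B' AB'] e.
pose D q := A q - A' q.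
have [C DC] : exists C : int, forall m n : int, n < C -> D (m, n) = 0.
  exists (Num.min B B') => m n.
  by rewrite lt_min => /andP[h h']; rewrite /D AB // AB' // subrr.
have De q : lact l D q = 0.
  have := congr1 (fun f => f q) e; rewrite /lact /= /D => h.
  by rewrite !mulrBr addrACA -opprD h subrr.
suff D0 (m n : int) : D (m, n) = 0.
  by apply/funext => -[m n]; apply/eqP; rewrite -subr_eq0; apply/eqP/D0.
case: (ltP n C) => [/DC //|nC].
have -> : n = C + `|n - C|%N%:Z by lia.
move: `|n - C|%N => k {n nC}.
case: l l0 e De => a b /= l0 _ De.
case: (eqVneq a 0) l0 De => [-> b0 De|a0 _ De].
  have := De (m, C + k%:Z + 1); rewrite /lact /= mul0r add0r addrK => /eqP.
  rewrite mulf_eq0 => /orP[/eqP b1|/eqP //].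
  by case/eqP: b0; rewrite b1.
elim: k m => [|k IH] m.
  have := De (m + 1, C); rewrite /lact /= addrK addr0 [X in _ * _ + b * X]DC.
    by rewrite mulr0 addr0 => /eqP; rewrite mulf_eq0 (negbTE a0) => /eqP.
  by lia.
have := De (m + 1, C + k.+1%:Z); rewrite /lact /= addrK.
have -> : C + k.+1%:Z - 1 = C + k%:Z by lia.
by rewrite IH mulr0 addr0 => /eqP; rewrite mulf_eq0 (negbTE a0) => /eqP.
Qed.

Definition lacts ls A := foldr lact A ls.

Lemma lact_lacts l ls A : lact l (lacts ls A) = lacts ls (lact l A).
Proof. by elim: ls => //= l' ls IH; rewrite lactC IH. Qed.

Lemma lactsC ls ls' A : lacts ls (lacts ls' A) = lacts ls' (lacts ls A).
Proof. by elim: ls => //= l ls ->; rewrite lact_lacts. Qed.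

Lemma bnd_lact l A : bnd A -> bnd (lact l A).
Proof.
move=> [B AB]; exists B => m n nB.
by rewrite /lact /= !AB ?mulr0 ?addr0 //; lia.
Qed.

Lemma bnd_lacts ls A : bnd A -> bnd (lacts ls A).
Proof. by move=> AB; elim: ls => //= l ls; apply: bnd_lact. Qed.

Lemma lacts_inj ls A A' : (0, 0) \notin ls -> bnd A -> bnd A' ->
  lacts ls A = lacts ls A' -> A = A'.
Proof.
move=> h AB AB'; elim: ls h => //= l ls IH; rewrite inE negb_or eq_sym.
by case/andP => l0 /IH {}IH /(lact_inj l0 (bnd_lacts _ AB) (bnd_lacts _ AB')).
Qed.

Lemma bnd_poly p : bnd (poly_series p).
Proof. by exists 0 => -[m|m] [n|n]. Qed.

Lemma poly_series_linform l p :
  poly_series (linform l * p) = lact l (poly_series p).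
Proof.
have cc c (q : polyF2) i j : (c%:P%:P * q)`_i`_j = c * q`_i`_j.
  by rewrite !coefCM.
have key m n : (linform l * p)`_m`_n =
    l.1 * (if m == 0 then 0 else p`_m.-1`_n)
    + l.2 * (if n == 0 then 0 else p`_m`_n.-1).
  rewrite mulrDl -!mulrA !coefD !cc coefXM coefCM coefXM.
  by case: m => [|m] /=; rewrite ?coef0.
suff main (m n : int) :
    poly_series (linform l * p) (m, n) = lact l (poly_series p) (m, n).
  by apply/funext => -[m n]; apply: main.
rewrite /lact /poly_series /=; case: m n => [m|m] [n|n] /=.
- by rewrite key; case: m n => [|m] [|n] /=; rewrite ?subn1.
- by case: m => [|m] /=; rewrite !mulr0 addr0.
- by rewrite !mulr0 addr0.
- by rewrite !mulr0 addr0.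
Qed.

Lemma poly_series_inj : injective poly_series.
Proof.
move=> p q e; apply/polyP => i; apply/polyP => j.
exact: (congr1 (fun f => f (i%:Z, j%:Z)) e).
Qed.

Lemma bnd_expand p ls : (0, 0) \notin ls -> bnd (expand p ls).
Proof.
elim: ls => [_|l ls IH]; first exact: bnd_poly.
by rewrite inE negb_or eq_sym => /andP[l0 /IH]; apply: bnd_smul.
Qed.

Lemma lacts_expand p ls : (0, 0) \notin ls ->
  lacts ls (expand p ls) = poly_series p.
Proof.
elim: ls => [//|l ls IH] /=.
rewrite inE negb_or eq_sym => /andP[l0 ls0].
by rewrite lact_lacts lact_smul ?IH //; apply: bnd_expand.
Qed.

Lemma poly_series_linforms p ls :
  poly_series (\prod_(l <- ls) linform l * p) = lacts ls (poly_series p).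
Proof.
elim: ls => [|l ls IH]; first by rewrite big_nil mul1r.
by rewrite big_cons -mulrA poly_series_linform IH.
Qed.

Lemma linform_neq0 l : l != (0, 0) -> linform l != 0.
Proof.
have e1 : (linform l)`_1`_0 = l.1.
  by rewrite /linform !coefD !coefCM !coefX !coefC /= mulr1 mulr0 addr0.
have e2 : (linform l)`_0`_1 = l.2.
  by rewrite /linform !coefD !coefCM !coefX !coefC /= coefX mulr1 mulr0 add0r.
apply: contraNneq => e; apply/eqP.
by rewrite [l]surjective_pairing -e1 -e2 e !coef0.
Qed.

Lemma linforms_neq0 ls : (0, 0) \notin ls -> \prod_(l <- ls) linform l != 0.
Proof.
elim: ls => [_|l ls IH]; first by rewrite big_nil oner_eq0.
rewrite inE negb_or eq_sym big_cons mulf_eq0 negb_or => /andP[l0 /IH ->].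
by rewrite linform_neq0.
Qed.

Lemma expand_eq p q ls ks : (0, 0) \notin ls -> (0, 0) \notin ks ->
  expand p ls = expand q ks <->
  p%:F / (\prod_(l <- ls) linform l)%:F = q%:F / (\prod_(l <- ks) linform l)%:F.
Proof.
move=> ls0 ks0.
rewrite (frac_eqP _ _ (linforms_neq0 ls0) (linforms_neq0 ks0)).
rewrite [p * _]mulrC [q * _]mulrC.
split=> [e|/(congr1 poly_series)].
  apply: poly_series_inj; rewrite !poly_series_linforms.
  by rewrite -(lacts_expand p ls0) -(lacts_expand q ks0) e lactsC.
rewrite !poly_series_linforms -(lacts_expand p ls0) -(lacts_expand q ks0).
rewrite (lactsC ls ks).
move=> /(lacts_inj ks0 (bnd_lacts _ (bnd_expand p ls0))).
move=> /(_ (bnd_lacts _ (bnd_expand q ks0))).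
by move/(lacts_inj ls0 (bnd_expand p ls0) (bnd_expand q ks0)).
Qed.

Lemma iota_ijE p ls : (0, 0) \notin ls ->
  iota_ij (p%:F / (\prod_(l <- ls) linform l)%:F) = expand p ls.
Proof.
move=> ls0; apply: xget_unique; first by exists p, ls.
by move=> A [q [ks [ks0 /(expand_eq p q ls0 ks0).2 -> ->]]].
Qed.

Lemma iota_ij_inj f g : ratS f -> ratS g -> iota_ij f = iota_ij g -> f = g.
Proof.
move=> [p [ls [ls0 ->]]] [q [ks [ks0 ->]]].
by rewrite !iota_ijE // => /(expand_eq p q ls0 ks0).1.
Qed.

Definition iota_inv (A : int * int -> F) : ratF2 :=
  xget 0 [set f | ratS f /\ iota_ij f = A].

Lemma iota_invK f : ratS f -> iota_inv (iota_ij f) = f.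
Proof.
move=> fS; apply: xget_unique => // g [gS].
by move=> /(iota_ij_inj gS fS).
Qed.

End Rational.

Section Substitution.
Variable F : fieldType.
Local Notation polyF2 := {poly {poly F}}.
Local Notation ratF2 := {fraction {poly {poly F}}}.

Section Sub.
Variables a b : polyF2.

(* p with 'X := a and 'Y := b. *)
Definition polysub (p : polyF2) : polyF2 :=
  (map_poly (fun c : {poly F} => (map_poly (polyC \o polyC) c).[b]) p).[a].

(* Used only for an injective polysub, where it does not depend on the
   numerator and denominator (see subx0E). *)
Definition ratsub (f : ratF2) : ratF2 :=
  (polysub \n_(repr f))%:F / (polysub \d_(repr f))%:F.
End Sub.

Definition subY (b : polyF2) (c : {poly F}) : polyF2 :=
  (map_poly (polyC \o polyC) c).[b].

Fact subY_zmod b : zmod_morphism (subY b).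
Proof. by move=> c d; rewrite /subY rmorphB hornerD hornerN. Qed.

Fact subY_monoid b : monoid_morphism (subY b).
Proof. by split=> [|c d]; rewrite /subY ?rmorph1 ?hornerC // rmorphM hornerM. Qed.

HB.instance Definition _ b :=
  GRing.isZmodMorphism.Build {poly F} polyF2 (subY b) (subY_zmod b).
HB.instance Definition _ b :=
  GRing.isMonoidMorphism.Build {poly F} polyF2 (subY b) (subY_monoid b).

Lemma polysubE a b p : polysub a b p = (map_poly (subY b) p).[a].
Proof. by []. Qed.

Fact polysub_zmod a b : zmod_morphism (polysub a b).
Proof. by move=> p q; rewrite !polysubE rmorphB hornerD hornerN. Qed.

Fact polysub_monoid a b : monoid_morphism (polysub a b).
Proof.
by split=> [|p q]; rewrite !polysubE ?rmorph1 ?hornerC // rmorphM hornerM.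
Qed.

HB.instance Definition _ a b :=
  GRing.isZmodMorphism.Build polyF2 polyF2 (polysub a b) (polysub_zmod a b).
HB.instance Definition _ a b :=
  GRing.isMonoidMorphism.Build polyF2 polyF2 (polysub a b) (polysub_monoid a b).

Lemma polysubX a b : polysub a b 'X = a.
Proof. by rewrite polysubE map_polyX hornerX. Qed.

Lemma polysubP a b c : polysub a b c%:P = subY b c.
Proof. by rewrite polysubE map_polyC hornerC. Qed.

Lemma polysubY a b : polysub a b 'Y = b.
Proof. by rewrite polysubP /subY map_polyX hornerX. Qed.

Lemma polysubC a b c : polysub a b c%:P%:P = c%:P%:P.
Proof. by rewrite polysubP /subY map_polyC hornerC. Qed.

Lemma polysub_id p (s : {rmorphism polyF2 -> polyF2}) :
  s 'X = 'X -> s 'Y = 'Y -> (forall c, s c%:P%:P = c%:P%:P) -> s p = p.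
Proof.
move=> sX sY sC; elim/poly_ind: p => [|p c IH]; first exact: rmorph0.
rewrite rmorphD rmorphM IH sX; congr (_ + _).
elim/poly_ind: c => [|c d IHc]; first by rewrite !polyC0 rmorph0.
by rewrite polyCD polyCM rmorphD rmorphM IHc sY sC.
Qed.

(* The substitution x0 := x1 - x2: 'X, 'Y stand for x2, x0 in the argument of
   subx0 and for x1, x2 in its value. *)
Definition subx0 : ratF2 -> ratF2 := ratsub 'Y ('X - 'Y).

Lemma polysub_x0K :
  cancel (polysub 'Y ('X - 'Y)) (polysub ('X + 'Y : polyF2) 'X).
Proof.
move=> p; pose s := polysub ('X + 'Y : polyF2) 'X \o polysub 'Y ('X - 'Y).
apply: (@polysub_id p s) => [||c]; rewrite /s /=.
- by rewrite polysubX polysubY.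
- by rewrite polysubY rmorphB /= polysubX polysubY addrAC subrr add0r.
- by rewrite !polysubC.
Qed.

Lemma subx0E (p q : polyF2) : q != 0 ->
  subx0 (p%:F / q%:F) =
  (polysub 'Y ('X - 'Y) p)%:F / (polysub 'Y ('X - 'Y) q)%:F.
Proof.
move=> q0; rewrite /subx0 /ratsub; set s := polysub _ _.
have s0 r : r != 0 -> s r != 0.
  by apply: contraNneq => e; rewrite -(polysub_x0K r) -/s e rmorph0.
set f := p%:F / q%:F; have dF := denom_ratioP (repr f).
have /(frac_eqP _ _ q0 dF).1 e := fracE f.
apply/(frac_eqP _ _ (s0 _ dF) (s0 _ q0)).
have := congr1 s e; rewrite [s (p * _)]rmorphM [s (_ * q)]rmorphM => ->.
by [].
Qed.
End Substitution.

Section Grading.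
Variable F : fieldType.

(* W is the internal direct sum of the subspaces gr k. *)
Record is_grading (W : lmodType F) (gr : int -> set W) : Prop := {
  gr0 : forall k, gr k 0;
  grP : forall k a u w, gr k u -> gr k w -> gr k (a *: u + w);
  gr_span : forall w, exists (s : seq int) (f : int -> W),
    (forall k, gr k (f k)) /\ w = \sum_(k <- s) f k;
  gr_indep : forall (s : seq int) (f : int -> W), uniq s ->
    (forall k, gr k (f k)) -> \sum_(k <- s) f k = 0 ->
    forall k, k \in s -> f k = 0 }.

(* Total weight: the span of the u (x) w with weights adding up to k. *)
Definition tensor_gr (U W : lmodType F) (grU : int -> set U) (grW : int -> set W)
    (k : int) : set (tensor U W) :=
  [set t | exists2 s : seq (U * W),
     forall p, p \in s -> exists i, grU i p.1 /\ grW (k - i) p.2 &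
     t = \sum_(p <- s) p.1 \ot p.2].

(* The graded dual, as a space of linear forms on W: the direct sum of the
   Hom(gr k, F) consists of the forms vanishing on all but finitely many of
   the gr k, and the pairing with W is evaluation. *)
Definition graded_dual (W : lmodType F) (gr : int -> set W) (phi : {scalar W}) :=
  exists s : seq int, forall k w, k \notin s -> gr k w -> phi w = 0.

End Grading.

Section VertexCoalgebra.
Variables (F : fieldType) (V : lmodType F).

(* Y n is the coefficient of x^n in the comultiplication Y(x), so that Delta_k
   is Y (- k - 1). *)
Variables (Y : int -> {linear V -> tensor V V}) (c : {scalar V}).

(* (Id (x) Y(y)) Y(x) v: coefficient of x^q.1 y^q.2.  The tensor cube of V is
   (V (x) V) (x) V. *)
Definition Yright (v : V) (q : int * int) : tensor (tensor V V) V :=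
  tassoc V V V (tmap idfun (Y q.2) (Y q.1 v)).

(* (Y(y) (x) Id) Y(x) v: coefficient of x^q.1 y^q.2. *)
Definition Yleft (v : V) (q : int * int) : tensor (tensor V V) V :=
  tmap (Y q.2) idfun (Y q.1 v).

(* In the next six definitions e = (exponents of x0, x1, x2). *)
Definition Y012_right (v : V) (e : int * int * int) : tensor (tensor V V) V :=
  let: (a, b, d) := e in if a == 0 then Yright v (b, d) else 0.

Definition Y012_swap (v : V) (e : int * int * int) : tensor (tensor V V) V :=
  let: (a, b, d) := e in
  if a == 0 then tmap (twist V V) idfun (Yright v (d, b)) else 0.

Definition Y012_left (v : V) (e : int * int * int) : tensor (tensor V V) V :=
  let: (a, b, d) := e in if b == 0 then Yleft v (d, a) else 0.

(* x0^-1 delta((x1 - x2) / x0) = sum_n x0^(-n-1) (x1 - x2)^n *)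
Definition delta_right (e : int * int * int) : F :=
  let: (a, b, d) := e in binpow (-1) (- a - 1) (b, d).

(* x0^-1 delta((x2 - x1) / - x0) = sum_n (-1)^n x0^(-n-1) (x2 - x1)^n *)
Definition delta_swap (e : int * int * int) : F :=
  let: (a, b, d) := e in (-1) ^ (- a - 1) * binpow (-1) (- a - 1) (d, b).

(* x2^-1 delta((x1 - x0) / x2) = sum_n x2^(-n-1) (x1 - x0)^n *)
Definition delta_left (e : int * int * int) : F :=
  let: (a, b, d) := e in binpow (-1) (- d - 1) (b, a).

Record is_vertex_coalgebra : Prop := {
  vc_left_counit : forall v n, contractl V c (Y n v) = if n == 0 then v else 0;
  vc_cocreation : forall v,
    (forall n, n < 0 -> contractr V c (Y n v) = 0) /\ contractr V c (Y 0 v) = v;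
  vc_truncation : forall v, exists N, forall n, N < n -> Y n v = 0;
  vc_jacobi : forall v e,
    smul delta_right (Y012_right v) e - smul delta_swap (Y012_swap v) e =
    smul delta_left (Y012_left v) e }.

Record is_graded_vertex_coalgebra (gr : int -> set V) : Prop := {
  gvc_vc : is_vertex_coalgebra;
  gvc_grading : is_grading gr;
  gvc_bounded : exists N, forall k v, k < N -> gr k v -> v = 0;
  gvc_weight : forall r k v, gr r v ->
    tensor_gr gr gr (r + k + 1) (Y (- k - 1) v) }.

End VertexCoalgebra.

(* F[y^-1, x][[y, x^-1]]: the series in x, y (in that order) whose powers of x
   are bounded above and whose powers of y are bounded below. *)
Definition laurent_xVy (F : fieldType) (A : int * int -> F) : Prop :=
  exists N : int, forall m n, (N < m) || (n < - N) -> A (m, n) = 0.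

(* Main.v *)
Require Import Defs.
From mathcomp Require Import all_boot all_order all_algebra.
From mathcomp Require Import fraction polyXY.
From mathcomp Require Import boolp classical_sets.
From mathcomp Require Import fsbigop.
From mathcomp Require Import ring zify.
Import GRing.Theory.
Local Open Scope ring_scope.

Set Implicit Arguments.
Unset Strict Implicit.
Unset Printing Implicit Defensive.
Import Order.TTheory.

(** Write R(x1, x2), W(x2, x1) and L(x2, x0) for the scalar series obtained by
    applying v' to (Id (x) Y(x2)) Y(x1) v, to its twisted counterpart
    (T (x) Id) (Id (x) Y(x1)) Y(x2) v, and to (Y(x0) (x) Id) Y(x2) v.

    Truncation bounds the powers of the first listed variable from above.  As
    v' sees finitely many weights and v has finitely many homogeneous
    components, only finitely many total degrees occur, so the powers of the
    second variable are bounded from below (graded_laurent).  One integer N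
    serves for the three series and for both variables.

    Two coefficients of the Jacobi identity are then enough.  In the
    coefficient of x0 ^ (- N - 1) the series L drops out, and
    (x1 - x2) ^ N R(x1, x2) = (x1 - x2) ^ N W(x2, x1) (weak_commutativity).
    The two sides are bounded in opposite directions, so this is a Laurent
    polynomial, and p = x2 ^ N (x1 - x2) ^ N x1 ^ N R is a polynomial
    (right_denominators).  In the coefficient of x1 ^ (- N - 1) the series W
    drops out, and (x0 + x2) ^ N L(x2, x0) is x1 ^ N R(x1, x2) with x0 + x2
    substituted for x1 and expanded in nonnegative powers of x2
    (weak_associativity).

    The substitution intertwines multiplication by x1, x2 and x1 - x2 with
    multiplication by x0 + x2, x2 and x0 (subst_expansion_lact), and on
    polynomials it is the ordinary one (subst_expansion_poly).  Therefore
    x2 ^ N x0 ^ N (x0 + x2) ^ N L = p(x0 + x2, x2).  Nonzero linear forms act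
    injectively on series with powers of the second variable bounded below,
    so these two equations determine R and L as expansions of
    p / (x2 ^ N (x1 - x2) ^ N x1 ^ N) and of
    p(x0 + x2, x2) / (x2 ^ N x0 ^ N (x0 + x2) ^ N), which correspond under
    x0 = x1 - x2. *)

(** * Gradings and tensor products *)

Section Gradings.
Variable F : fieldType.

Lemma tensor_gr_sum (U W : lmodType F) (grU : int -> set U) (grW : int -> set W)
    (k : int) (I : eqType) (s : seq I) (f : I -> tensor U W) :
  (forall i, i \in s -> tensor_gr grU grW k (f i)) ->
  tensor_gr grU grW k (\sum_(i <- s) f i).
Proof.
elim: s => [|i s IH] fk; first by rewrite big_nil; exists [::]; rewrite ?big_nil.
have [|t tk sE] := IH; first by move=> j js; apply: fk; rewrite inE js orbT.
have [u uk fiE] := fk i (mem_head _ _).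
exists (u ++ t); last by rewrite big_cons fiE sE big_cat.
by move=> p; rewrite mem_cat => /orP[/uk|/tk].
Qed.

Lemma tensor_gr_pure (U W : lmodType F) (grU : int -> set U)
    (grW : int -> set W) (i j : int) u w :
  grU i u -> grW j w -> tensor_gr grU grW (i + j) (u \ot w).
Proof.
move=> ui wj; exists [:: (u, w)]; last by rewrite big_seq1.
by move=> p; rewrite inE => /eqP ->; exists i; rewrite addrAC subrr add0r.
Qed.

(** It is enough to check what a linear map does to the weight of pure tensors,
    because these span each weight space. *)
Lemma tensor_gr_linear (U W X : lmodType F) (grU : int -> set U)
    (grW : int -> set W) (grX : int -> set X) (f : {linear tensor U W -> X})
    (e k : int) t :
  (forall l (I : eqType) (s : seq I) (g : I -> X),
    (forall i, i \in s -> grX l (g i)) -> grX l (\sum_(i <- s) g i)) ->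
  (forall i j u w, grU i u -> grW j w -> grX (i + j + e) (f (u \ot w))) ->
  tensor_gr grU grW k t -> grX (k + e) (f t).
Proof.
move=> grX_sum fe [s sk ->]; rewrite linear_sum; apply: grX_sum => p /sk.
by move=> [i [pi pj]]; have := fe _ _ _ _ pi pj; rewrite [i + _]addrC subrK.
Qed.

Lemma tmap_gr (U U' W W' : lmodType F) (grU : int -> set U)
    (grU' : int -> set U') (grW : int -> set W) (grW' : int -> set W')
    (f : {linear U -> U'}) (g : {linear W -> W'}) (a b k : int) t :
  (forall i u, grU i u -> grU' (i + a) (f u)) ->
  (forall i w, grW i w -> grW' (i + b) (g w)) ->
  tensor_gr grU grW k t -> tensor_gr grU' grW' (k + (a + b)) (tmap f g t).
Proof.
move=> fa gb; apply: tensor_gr_linear; first by move=> *; apply: tensor_gr_sum.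
move=> i j u w /fa ui /gb wj; rewrite tmapE addrACA.
exact: tensor_gr_pure.
Qed.

Lemma twist_gr (U W : lmodType F) (grU : int -> set U) (grW : int -> set W)
    (k : int) t :
  tensor_gr grU grW k t -> tensor_gr grW grU k (twist U W t).
Proof.
rewrite -[in X in _ -> X](addr0 k).
apply: tensor_gr_linear; first by move=> *; apply: tensor_gr_sum.
by move=> i j u w ui wj; rewrite twistE addr0 addrC; apply: tensor_gr_pure.
Qed.

Lemma tassoc_gr (U W X : lmodType F) (grU : int -> set U) (grW : int -> set W)
    (grX : int -> set X) (k : int) t :
  tensor_gr grU (tensor_gr grW grX) k t ->
  tensor_gr (tensor_gr grU grW) grX k (tassoc U W X t).
Proof.
rewrite -[in X in _ -> X](addr0 k).
apply: tensor_gr_linear; first by move=> *; apply: tensor_gr_sum.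
move=> i j u t' ui [s sj ->]; rewrite addr0 linear_sumr linear_sum.
apply: tensor_gr_sum => p /sj [l [wl xl]]; rewrite /= tassocE.
have -> : i + j = (i + l) + (j - l) by rewrite addrACA subrr addr0.
by apply: tensor_gr_pure => //; apply: tensor_gr_pure.
Qed.

Lemma int_seq_bounded (s : seq int) :
  exists B : int, forall k, k \in s -> - B <= k <= B.
Proof.
elim: s => [|i s [B sB]]; first by exists 0.
exists (`|i| + `|B|) => k; rewrite inE => /orP[/eqP ->|/sB]; lia.
Qed.

(** An operator of bidegree (m, q) that lowers the weight by m + q can meet a
    form supported in finitely many weights only for m + q in a finite set;
    truncation in m therefore bounds q from below. *)
Lemma graded_laurent (V W : lmodType F) (gr : int -> set V) (grW : int -> set W)
    (Z : int -> int -> {linear V -> W}) (phi : {scalar W}) (v : V) :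
  is_grading gr -> graded_dual grW phi ->
  (forall r m q w, gr r w -> grW (r - m - q) (Z m q w)) ->
  (exists N, forall m q, N < m -> Z m q v = 0) ->
  laurent_xVy (fun e => phi (Z e.1 e.2 v)).
Proof.
move=> grV [s phis] Zgr [N ZN].
have [s' [f [fgr vE]]] := gr_span grV v.
have [B sB] := int_seq_bounded s; have [B' sB'] := int_seq_bounded s'.
exists (`|N| + `|B| + `|B'|) => m q out /=.
have [/ZN ->|mN] := ltP N m; first by rewrite linear0.
rewrite vE !linear_sum big_seq big1 // => k /sB' kB.
apply: (phis (k - m - q)); last exact: Zgr.
by apply/negP => /sB; lia.
Qed.

End Gradings.

(** * Binomial coefficients and multiplication by linear forms *)

Section Series.
Variable F : fieldType.
Hypothesis charF0 : [pchar F] =i pred0.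
Implicit Types A D : int * int -> F.

Lemma bincoef0r n : bincoef F n 0 = 1.
Proof. by rewrite /bincoef big_ord0 divr1. Qed.

Lemma bincoef0l k : bincoef F 0 k = (k == 0%N)%:R.
Proof.
case: k => [|k]; first exact: bincoef0r.
by rewrite /bincoef big_ord_recl subrr mul0r mul0r.
Qed.

Lemma bincoefS n k :
  bincoef F (n + 1) k.+1 = bincoef F n k.+1 + bincoef F n k.
Proof.
have nz m : m.+1%:R != 0 :> F by rewrite (pcharf0P F).1.
have fz : (k`!)%:R != 0 :> F by rewrite (pcharf0P F).1 // -lt0n fact_gt0.
rewrite /bincoef big_ord_recl big_ord_recr /= factS natrM.
under eq_bigr => i _ do
  rewrite /bump leq0n add1n intrD -[i.+1]addn1 natrD opprD addrACA subrr addr0.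
set P := \prod_(i < k) _; have := nz k; rewrite -[k.+1]addn1 natrD intrD => k1.
by field; rewrite k1 fz.
Qed.

(** The upper negation of a binomial coefficient. *)
Lemma bincoef_neg n k : bincoef F n k * (-1) ^+ k = bincoef F (k%:Z - 1 - n) k.
Proof.
rewrite /bincoef mulrAC; congr (_ / _).
rewrite [RHS](reindex_inj rev_ord_inj) /= mulrC -[k in (-1) ^+ k]card_ord.
rewrite -prodrN; apply: eq_bigr => j _.
rewrite natrB // -addn1 natrD !intrD !mulrNz -pmulrn; ring.
Qed.
Lemma lacts_cat ls ls' A : lacts (ls ++ ls') A = lacts ls (lacts ls' A).
Proof. by rewrite /lacts foldr_cat. Qed.

Lemma lacts_nseq_binomial (s : F) n K A m q : (n < K)%N ->
  lacts (nseq n (1, s)) A (m, q) =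
  \sum_(k < K) bincoef F n k * s ^+ k * A (m - n%:Z + k%:Z, q - k%:Z).
Proof.
elim: n K m q => [|n IH] [//|K] m q nK.
  rewrite big_ord_recl bincoef0r expr0 mulr1 mul1r subr0 addr0 subr0.
  by rewrite big1 ?addr0 // => k _; rewrite bincoef0l !mul0r.
rewrite /= /lact (IH K.+1) ?(IH K) //=; last exact: ltnW.
rewrite !big_ord_recl /= !bincoef0r !mul1r -!addrA; congr (_ + _).
  by congr (A (_, _)); lia.
rewrite mulr_sumr -big_split; apply: eq_bigr => k _ /=.
rewrite /bump leq0n add1n -[n.+1]addn1 PoszD bincoefS exprS.
set a := A _; set b := A _; set c := A _.
have -> : a = c by congr (A (_, _)); lia.
have -> : b = c by congr (A (_, _)); lia.
ring.
Qed.

Lemma lacts_nseq_shift1 n A m q :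
  lacts (nseq n (1, 0)) A (m, q) = A (m - n%:Z, q).
Proof.
elim: n m => [|n IH] m /=; first by rewrite subr0.
by rewrite /lact /= mul1r mul0r addr0 IH; congr (A (_, _)); lia.
Qed.

Lemma lacts_nseq_shift2 n A m q :
  lacts (nseq n (0, 1)) A (m, q) = A (m, q - n%:Z).
Proof.
elim: n q => [|n IH] q /=; first by rewrite subr0.
by rewrite /lact /= mul1r mul0r add0r IH; congr (A (_, _)); lia.
Qed.

Lemma laurent_bnd A : laurent_xVy A -> bnd A.
Proof. by move=> [N AN]; exists (- N) => m q qN; apply: AN; rewrite qN orbT. Qed.

Lemma box_poly_series (B : nat) A :
  (forall m q, ~~ ((0 <= m <= B%:Z) && (0 <= q <= B%:Z)) -> A (m, q) = 0) ->
  exists p, A = poly_series p.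
Proof.
move=> AB; exists (\poly_(i < B.+1) \poly_(j < B.+1) A (i%:Z, j%:Z)).
suff AE (m q : int) : A (m, q) = poly_series
    (\poly_(i < B.+1) \poly_(j < B.+1) A (i%:Z, j%:Z)) (m, q).
  by apply/funext => -[m q]; apply: AE.
case: m q => [m|m] [q|q]; rewrite /poly_series /=; try by rewrite AB //; lia.
rewrite coef_poly; case: ltnP => mB; last by rewrite coef0 AB //; lia.
by rewrite coef_poly; case: ltnP => // qB; rewrite AB //; lia.
Qed.

(** * The substitution x1 = x0 + x2 *)

(** The series D in (x2, x0) arises from the series A in (x1, x2) when each
    x1 ^ n becomes (x0 + x2) ^ n, expanded in nonnegative powers of x2.  The
    sum over k is infinite in general; the definition asks that it stabilise. *)
Definition subst_expansion A D : Prop :=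
  forall d a : int, exists K0 : nat, forall K, (K0 <= K)%N ->
    D (d, a) = \sum_(k < K) bincoef F (a + k%:Z) k * A (a + k%:Z, d - k%:Z).

(** The form l1 x1 + l2 x2 at x1 = x0 + x2, as a form in (x2, x0). *)
Definition subst_form (l : F * F) : F * F := (l.1 + l.2, l.1).

(** Multiplying A by a linear form multiplies D by the substituted form: on
    coefficients this is Pascal's rule. *)
Lemma subst_expansion_lact l A D : bnd A -> subst_expansion A D ->
  subst_expansion (lact l A) (lact (subst_form l) D).
Proof.
move=> [B AB] AD d a.
have [K1 e1] := AD (d - 1) a; have [K2 e2] := AD d (a - 1).
exists (K1 + K2 + `|d - B| + 1)%N.+1 => -[//|K] KK; rewrite /lact /=.
rewrite (e1 K.+1) ?(e2 K.+1); [|lia..].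
pose p k := bincoef F (a + k%:Z) k * A (a + k%:Z, d - 1 - k%:Z).
pose r k := bincoef F (a - 1 + k%:Z) k * A (a - 1 + k%:Z, d - k%:Z).
have p_last : p K = 0 by rewrite /p AB ?mulr0 //; lia.
(* p shifted by one, to be paired with r in Pascal's rule. *)
pose p' k := if k is k'.+1 then p k' else 0.
have p_shift : \sum_(k < K.+1) p k = \sum_(k < K.+1) p' k.
  by rewrite big_ord_recr /= p_last addr0 [RHS]big_ord_recl /= add0r.
transitivity (l.1 * \sum_(k < K.+1) p' k + l.2 * \sum_(k < K.+1) p k
    + l.1 * \sum_(k < K.+1) r k).
  by rewrite -p_shift mulrDl.
rewrite !mulr_sumr -!big_split; apply: eq_bigr => -[k kK] _ /=.
have pascal : bincoef F (a + k%:Z) k * A (a + k%:Z - 1, d - k%:Z) = r k + p' k.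
  rewrite /r /p' /p; case: k {kK} => [|k].
    by rewrite !bincoef0r !mul1r [RHS]addr0; congr (A (_, _)); lia.
  have -> : a - 1 + k.+1%:Z = a + k%:Z by lia.
  have -> : a + k.+1%:Z = a + k%:Z + 1 by lia.
  have -> : d - 1 - k%:Z = d - k.+1%:Z by lia.
  by rewrite addrK bincoefS mulrDl.
have -> : d - k%:Z - 1 = d - 1 - k%:Z by lia.
transitivity (l.1 * (r k + p' k) + l.2 * p k); first by ring.
by rewrite -pascal /p; ring.
Qed.

Lemma subst_expansion_lacts ls A D : bnd A -> subst_expansion A D ->
  subst_expansion (lacts ls A) (lacts [seq subst_form l | l <- ls] D).
Proof.
move=> bA AD; elim: ls => //= l ls IH.
by apply: subst_expansion_lact => //; apply: bnd_lacts.
Qed.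

Lemma subst_expansion_uniq A D D' :
  subst_expansion A D -> subst_expansion A D' -> D = D'.
Proof.
move=> AD AD'; suff DD' (d a : int) : D (d, a) = D' (d, a).
  by apply/funext => -[d a]; apply: DD'.
have [K e] := AD d a; have [K' e'] := AD' d a.
by rewrite (e (K + K')%N) ?(e' (K + K')%N) ?leq_addr ?leq_addl.
Qed.

Lemma subst_expansionD A A' D D' :
  subst_expansion A D -> subst_expansion A' D' ->
  subst_expansion (fun e => A e + A' e) (fun e => D e + D' e).
Proof.
move=> AD AD' d a; have [K e] := AD d a; have [K' e'] := AD' d a.
exists (K + K')%N => N KN; rewrite (e N) ?(e' N); [|lia..].
by rewrite -big_split; apply: eq_bigr => k _; rewrite mulrDr.
Qed.

Lemma poly_seriesD (p q : {poly {poly F}}) :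
  poly_series (p + q) = (fun e => poly_series p e + poly_series q e).
Proof.
apply/funext => -[m q']; rewrite /poly_series /=.
by case: m q' => [m|m] [q'|q']; rewrite ?addr0 // !coefD.
Qed.

Lemma subst_expansion_const (c : F) :
  subst_expansion (poly_series c%:P%:P) (poly_series c%:P%:P).
Proof.
have cE (m q : int) : poly_series c%:P%:P (m, q) =
    if (m == 0) && (q == 0) then c else 0.
  case: m q => [[|m]|m] [[|q]|q] //; rewrite /poly_series /=.
  - by rewrite !coefC.
  - by rewrite !coefC.
  - by rewrite coefC /= coef0.
  - by rewrite coefC /= coef0.
move=> d a; exists `|d|.+1 => K dK; rewrite cE.
case: (eqVneq d 0) dK => [-> | d0] dK.
  case: K dK => // K _; rewrite big_ord_recl big1 => [|k _].
    rewrite bincoef0r mul1r [RHS]addr0 cE /= subr0.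
    by congr (if _ then _ else _); lia.
  by rewrite cE [_ - _ == 0](_ : _ = false) ?andbF ?mulr0 //; apply/negbTE; lia.
rewrite big1 // => k _; rewrite cE.
case: andP => [[/eqP e /eqP e']|]; last by rewrite mulr0.
rewrite e bincoef0l [_ == 0%N](_ : _ = false) ?mul0r //; apply/negbTE; lia.
Qed.

Lemma linform_X : linform (1, 0) = 'X :> {poly {poly F}}.
Proof. by rewrite /linform /= mul0r addr0 mul1r. Qed.

Lemma linform_Y : linform (0, 1) = 'Y :> {poly {poly F}}.
Proof. by rewrite /linform /= mul0r add0r mul1r. Qed.

Lemma polysub_linform l :
  polysub ('X + 'Y) 'X (linform l) = linform (subst_form l).
Proof.
rewrite /linform rmorphD !rmorphM /= !polysubC polysubX polysubY /= !polyCD.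
ring.
Qed.

Lemma polysub_x1K :
  cancel (polysub ('X + 'Y : {poly {poly F}}) 'X) (polysub 'Y ('X - 'Y)).
Proof.
move=> p.
pose s := polysub 'Y ('X - 'Y) \o polysub ('X + 'Y : {poly {poly F}}) 'X.
apply: (@polysub_id _ p s) => [||a]; rewrite /s /=.
- by rewrite polysubX rmorphD /= polysubX polysubY addrC subrK.
- by rewrite polysubY polysubX.
- by rewrite !polysubC.
Qed.

Lemma polysub_linforms ls :
  polysub ('X + 'Y) 'X (\prod_(l <- ls) linform l) =
  \prod_(l <- [seq subst_form l | l <- ls]) linform l.
Proof.
by rewrite rmorph_prod big_map; apply: eq_bigr => l _; apply: polysub_linform.
Qed.

Lemma subst_form_neq0 ls :
  (0, 0) \notin ls -> (0, 0) \notin [seq subst_form l | l <- ls].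
Proof.
apply: contra => /mapP[[a b] abl [ab0 a0]]; move: abl ab0.
by rewrite -a0 add0r => + b0; rewrite -b0.
Qed.

(** On polynomials the expansion is the substitution itself. *)
Lemma subst_expansion_poly p :
  subst_expansion (poly_series p) (poly_series (polysub ('X + 'Y) 'X p)).
Proof.
have mulX q : subst_expansion (poly_series q)
      (poly_series (polysub ('X + 'Y) 'X q)) ->
    forall l, subst_expansion (poly_series (linform l * q))
      (poly_series (polysub ('X + 'Y) 'X (linform l * q))).
  move=> IH l; rewrite rmorphM /= polysub_linform !poly_series_linform.
  by apply: subst_expansion_lact => //; apply: bnd_poly.
elim/poly_ind: p => [|p c IH].
  by rewrite rmorph0; apply: (subst_expansion_const 0).
rewrite rmorphD /= !poly_seriesD; apply: subst_expansionD.
  rewrite (_ : p * 'X = linform (1, 0) * p); first exact: mulX.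
  by rewrite linform_X mulrC.
elim/poly_ind: c => [|c a IHc].
  rewrite polyC0 rmorph0 -polyC0.
  exact: (subst_expansion_const 0).
rewrite !polyCD rmorphD /= !poly_seriesD; apply: subst_expansionD.
  rewrite (_ : (c * 'X)%:P = linform (0, 1) * c%:P); first exact: mulX.
  by rewrite linform_Y polyCM mulrC.
by rewrite polysubC; apply: subst_expansion_const.
Qed.
End Series.

(** * The Jacobi identity for coefficients *)

(** A product of series as a finite sum, when h enumerates the exponents at
    which both factors may be nonzero. *)
Lemma smul_ord (F : fieldType) (G : zmodType) (W : lmodType F) (f : G -> F)
    (A : G -> W) (g : G) (K : nat) (h : nat -> G) :
  injective h ->
  (forall p, f p = 0 \/ A (g - p) = 0 \/ exists2 k, (k < K)%N & p = h k) ->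
  smul f A g = \sum_(k < K) f (h k) *: A (g - h k).
Proof.
move=> h_inj hP; rewrite /smul (fsbigE [seq h k | k <- seq.iota 0 K]) //=.
- rewrite big_map (eq_bigl xpredT) => [|k]; last by rewrite in_setT.
  by rewrite -[K in LHS]subn0 big_mkord.
- by rewrite map_inj_uniq ?iota_uniq.
move=> p _ /mapP ph; have [->|[->|[k kK pE]]] := hP p.
- by rewrite scale0r.
- by rewrite scaler0.
by case: ph; exists k => //; rewrite mem_iota.
Qed.

Section Jacobi.
Variables (F : fieldType) (V : lmodType F) (Y : int -> {linear V -> tensor V V}).

Lemma binpowE (s : F) n i k :
  binpow s n (i, Posz k) = if i == n - k%:Z then bincoef F n k * s ^+ k else 0.
Proof. by []. Qed.

Variables (v : V) (N : int).
Hypothesis YN : forall n, N < n -> Y n v = 0.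

Lemma Yright0 b d : N < b -> Yright Y v (b, d) = 0.
Proof. by move=> Nb; rewrite /Yright /= YN // !linear0. Qed.

Lemma Yleft0 d a : N < d -> Yleft Y v (d, a) = 0.
Proof. by move=> Nd; rewrite /Yleft /= YN // linear0. Qed.

(** In each term of the Jacobi identity the delta function leaves one free
    summation index k, and truncation of Y cuts it off: any K beyond that point
    gives the same sum, which allows a common K for the three terms. *)
Lemma jacobi_right a b d K : N < b + a + 1 + K%:Z ->
  smul (delta_right F) (Y012_right Y v) (a, b, d) =
  \sum_(k < K) (bincoef F (- a - 1) k * (-1) ^+ k) *:
    Yright Y v (b + a + 1 + k%:Z, d - k%:Z).
Proof.
move=> NK; rewrite (smul_ord (K := K) (h := fun k => (a, - a - 1 - k%:Z, k%:Z))).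
- apply: eq_bigr => k _; rewrite /delta_right binpowE eqxx /=; congr (_ *: _).
  by rewrite /= subrr eqxx; congr (Yright _ _ (_, _)); lia.
- by move=> i j [].
move=> [[a' b'] d']; rewrite /delta_right /Y012_right /=.
case: d' => [k|k]; last by left.
rewrite binpowE; case: eqP => [b'E|_]; last by left.
case: eqP => [a'E|_]; last by right; left.
case: (ltnP k K) => kK; last by right; left; apply: Yright0; lia.
by right; right; exists k => //; congr (_, _, _); lia.
Qed.

Lemma jacobi_swap a b d K : N < d + a + 1 + K%:Z ->
  smul (delta_swap F) (Y012_swap Y v) (a, b, d) =
  \sum_(k < K) ((-1) ^ (- a - 1) * (bincoef F (- a - 1) k * (-1) ^+ k)) *:
    tmap (twist V V) idfun (Yright Y v (d + a + 1 + k%:Z, b - k%:Z)).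
Proof.
move=> NK; rewrite (smul_ord (K := K) (h := fun k => (a, k%:Z, - a - 1 - k%:Z))).
- apply: eq_bigr => k _; rewrite /delta_swap binpowE eqxx /=; congr (_ *: _).
  rewrite /= subrr eqxx; congr (tmap _ _ (Yright _ _ (_, _))); lia.
- by move=> i j [].
move=> [[a' b'] d']; rewrite /delta_swap /Y012_swap /=.
case: b' => [k|k]; last by left; rewrite mulr0.
rewrite binpowE; case: eqP => [d'E|_]; last by left; rewrite mulr0.
case: eqP => [a'E|_]; last by right; left.
case: (ltnP k K) => kK; last by right; left; rewrite Yright0 ?linear0 //; lia.
by right; right; exists k => //; congr (_, _, _); lia.
Qed.

Lemma jacobi_left a b d K : N < d + b + 1 + K%:Z ->
  smul (delta_left F) (Y012_left Y v) (a, b, d) =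
  \sum_(k < K) (bincoef F (b + k%:Z) k * (-1) ^+ k) *:
    Yleft Y v (d + b + 1 + k%:Z, a - k%:Z).
Proof.
move=> NK; rewrite (smul_ord (K := K) (h := fun k => (k%:Z, b, - b - 1 - k%:Z))).
- apply: eq_bigr => k _; rewrite /delta_left binpowE.
  have -> : - (- b - 1 - k%:Z) - 1 = b + k%:Z by lia.
  rewrite addrK eqxx /=; congr (_ *: _).
  by rewrite /= subrr eqxx; congr (Yleft _ _ (_, _)); lia.
- by move=> i j [].
move=> [[a' b'] d']; rewrite /delta_left /Y012_left /=.
case: a' => [k|k]; last by left.
rewrite binpowE; case: eqP => [b'E|_]; last by left.
case: eqP => [bE|_]; last by right; left.
case: (ltnP k K) => kK; last by right; left; apply: Yleft0; lia.
by right; right; exists k => //; congr (_, _, _); lia.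
Qed.

Variable c : {scalar V}.
Hypothesis vcY : is_vertex_coalgebra Y c.
Variable phi : {scalar tensor (tensor V V) V}.
Let R e := phi (Yright Y v e).
Let W e := phi (tmap (twist V V) idfun (Yright Y v e)).
Let L e := phi (Yleft Y v e).

Lemma jacobi_scalar a b d K :
  N < b + a + 1 + K%:Z -> N < d + a + 1 + K%:Z -> N < d + b + 1 + K%:Z ->
  \sum_(k < K) bincoef F (- a - 1) k * (-1) ^+ k *
    R (b + a + 1 + k%:Z, d - k%:Z)
  - (-1) ^ (- a - 1) * (\sum_(k < K) bincoef F (- a - 1) k * (-1) ^+ k *
    W (d + a + 1 + k%:Z, b - k%:Z)) =
  \sum_(k < K) bincoef F (b + k%:Z) k * (-1) ^+ k *
    L (d + b + 1 + k%:Z, a - k%:Z).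
Proof.
move=> KR KW KL; have := congr1 phi (vc_jacobi vcY v (a, b, d)).
rewrite (jacobi_right _ KR) (jacobi_swap _ KW) (jacobi_left _ KL).
rewrite linearB !linear_sum mulr_sumr /= => e.
transitivity (\sum_(i < K) phi ((bincoef F (b + i%:Z) i * (-1) ^+ i) *:
    Yleft Y v (d + b + 1 + i%:Z, a - i%:Z))).
  rewrite -e; congr (_ - _); apply: eq_bigr => k _; rewrite linearZ //=.
  by rewrite mulrA.
by apply: eq_bigr => k _; rewrite linearZ.
Qed.

End Jacobi.

(** * Commutativity, associativity and rationality *)

Section Rationality.
Variables (F : fieldType) (V : lmodType F) (Y : int -> {linear V -> tensor V V}).
Hypothesis charF0 : [pchar F] =i pred0.
Variables (c : {scalar V}) (v : V) (phi : {scalar tensor (tensor V V) V}).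
Variable N : nat.
Let R e := phi (Yright Y v e).
Let W e := phi (tmap (twist V V) idfun (Yright Y v e)).
Let L e := phi (Yleft Y v e).
Hypothesis vcY : is_vertex_coalgebra Y c.
Hypothesis YN : forall n : int, N%:Z < n -> Y n v = 0.
Hypothesis RN : forall m q : int, (N%:Z < m) || (q < - N%:Z) -> R (m, q) = 0.
Hypothesis WN : forall m q : int, (N%:Z < m) || (q < - N%:Z) -> W (m, q) = 0.
Hypothesis LN : forall m q : int, (N%:Z < m) || (q < - N%:Z) -> L (m, q) = 0.

(** The coefficient of x0 ^ (- N - 1) in the Jacobi identity: L has no powers
    of x0 this low, so the right-hand side is absent. *)
Lemma weak_commutativity b d :
  lacts (nseq N (1, -1)) R (b, d) =
  (-1) ^+ N * lacts (nseq N (1, -1)) W (d, b).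
Proof.
have [K KN KE] : exists2 K, (N < K)%N & (3 * N + `|b| + `|d| < K)%N.
  by exists (3 * N + `|b| + `|d|).+1; lia.
have := jacobi_scalar YN vcY phi (a := - N%:Z - 1) (b := b) (d := d) (K := K).
have -> : - (- N%:Z - 1) - 1 = N%:Z by lia.
have -> : b + (- N%:Z - 1) + 1 = b - N%:Z by lia.
have -> : d + (- N%:Z - 1) + 1 = d - N%:Z by lia.
move=> /(_ ltac:(lia) ltac:(lia) ltac:(lia)).
rewrite [RHS]big1 => [|k _]; last by rewrite [phi _]LN ?mulr0 //; lia.
move=> /eqP; rewrite subr_eq0 => /eqP.
by rewrite !(lacts_nseq_binomial charF0 _ _ _ _ KN).
Qed.

(** The coefficient of x1 ^ (- N - 1) in the Jacobi identity: W has no powers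
    of x1 this low, so the second term is absent.  This says that
    (x0 + x2) ^ N L(x2, x0) is x1 ^ N R(x1, x2) at x1 = x0 + x2. *)
Lemma weak_associativity :
  subst_expansion (lacts (nseq N (1, 0)) R) (lacts (nseq N (1, 1)) L).
Proof.
move=> d a; exists (3 * N + `|a| + `|d|).+1 => K KN.
have KN' : (N < K)%N by lia.
have := jacobi_scalar YN vcY phi (a := a) (b := - N%:Z - 1) (d := d) (K := K).
have -> : - N%:Z - 1 + a + 1 = a - N%:Z by lia.
have -> : d + (- N%:Z - 1) + 1 = d - N%:Z by lia.
move=> /(_ ltac:(lia) ltac:(lia) ltac:(lia)).
rewrite [X in _ * X]big1 => [|k _]; last by rewrite [phi _]WN ?mulr0 //; lia.
rewrite mulr0 subr0 (lacts_nseq_binomial charF0 _ _ _ _ KN') => e.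
transitivity (\sum_(k < K) bincoef F (- N%:Z - 1 + k%:Z) k * (-1) ^+ k *
    L (d - N%:Z + k%:Z, a - k%:Z)).
  apply: eq_bigr => k _; rewrite expr1n mulr1 bincoef_neg //.
  by congr (bincoef _ _ _ * _); lia.
rewrite -e; apply: eq_bigr => k _; rewrite lacts_nseq_shift1 bincoef_neg //.
by congr (bincoef _ _ _ * R (_, _)); lia.
Qed.

(** Weak commutativity equates a series with powers of x1 bounded above and
    powers of x2 bounded below with one of the opposite kind, so both are
    Laurent polynomials; the other factors clear the negative powers. *)
Lemma right_denominators :
  exists p, lacts (nseq N (0, 1) ++ nseq N (1, -1) ++ nseq N (1, 0)) R =
    poly_series p.
Proof.
have low A : (forall m q : int, (N%:Z < m) || (q < - N%:Z) -> A (m, q) = 0) ->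
    forall m q : int, (N%:Z + N%:Z < m) || (q < - N%:Z) ->
      lacts (nseq N (1, -1)) A (m, q) = 0 :> F.
  move=> AN m q out; rewrite (lacts_nseq_binomial charF0 _ _ _ _ (ltnSn N)).
  by rewrite big1 // => k _; rewrite AN ?mulr0 //; have := ltn_ord k; lia.
apply: (@box_poly_series _ (3 * N)) => m q out.
rewrite !lacts_cat lacts_nseq_shift2 lactsC lacts_nseq_shift1.
case out' : ((N%:Z + N%:Z < m - N%:Z) || (q - N%:Z < - N%:Z)).
  exact: (low _ RN).
rewrite weak_commutativity (low _ WN) ?mulr0 //; lia.
Qed.

End Rationality.

Lemma laurent_nat (F : fieldType) (A : int * int -> F) : laurent_xVy A ->
  exists N0 : nat, forall N, (N0 <= N)%N ->
    forall m q : int, (N%:Z < m) || (q < - N%:Z) -> A (m, q) = 0.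
Proof.
by move=> [B AB]; exists `|B|%N => N BN m q out; apply: AB; move: out; lia.
Qed.

(** Clearing denominators is injective on series with powers of the second
    variable bounded below, so a cleared equation recovers the expansion. *)
Lemma expand_of_lacts (F : fieldType) (charF0 : [pchar F] =i pred0)
    (A : int * int -> F) p ls :
  (0, 0) \notin ls -> bnd A -> lacts ls A = poly_series p -> A = expand p ls.
Proof.
move=> ls0 bA Ap; apply: (lacts_inj ls0 bA); first exact: bnd_expand.
by rewrite lacts_expand.
Qed.

Theorem proposition2p10 (F : fieldType) (charF0 : [pchar F] =i pred0)
    (V : lmodType F) (Y : int -> {linear V -> tensor V V}) (c : {scalar V})
    (gr : int -> set V) (HV : is_graded_vertex_coalgebra Y c gr)
    (v' : {scalar tensor (tensor V V) V})
    (Hv' : graded_dual (tensor_gr (tensor_gr gr gr) gr) v') (v : V) :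
  (* exponents of (x2, x0) *)
  let S20 : int * int -> F := fun q => v' (Yleft Y v q) in
  (* exponents of (x1, x2) *)
  let S12 : int * int -> F := fun q => v' (Yright Y v q) in
  (laurent_xVy S20 /\
   exists k : {fraction {poly {poly F}}},
     [/\ ratS k,
         S20 = iota_ij k,
         (forall k', ratS k' -> S20 = iota_ij k' -> k' = k) &
         let x2 : {poly {poly F}} := 'X in
         let x0 : {poly {poly F}} := 'Y in
         exists (h : {poly {poly F}}) (r s t : int),
           k = h%:F / (x0%:F ^ r * x2%:F ^ s * (x0 + x2)%:F ^ t)]) /\
  ((exists2 f, ratS f & S12 = iota_ij f) /\
   iota_inv S12 = subx0 (iota_inv S20)).
Proof.
move=> S20 S12; have vcY := gvc_vc HV.
pose S12' q := v' (tmap (twist V V) idfun (Yright Y v q)).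
have [NY YN] := vc_truncation vcY v.
have Ygr m r w : gr r w -> tensor_gr gr gr (r - m) (Y m w).
  by move=> /(gvc_weight HV (- m - 1)); congr (tensor_gr _ _ _ (Y _ _)); lia.
have Rgr m q r w : gr r w ->
    tensor_gr (tensor_gr gr gr) gr (r - m - q) (Yright Y w (m, q)).
  move=> /(Ygr m) Yw; apply: tassoc_gr; rewrite -[- q]add0r.
  by apply: tmap_gr Yw => i u ui; rewrite ?addr0 //; apply: Ygr.
have S20L : laurent_xVy S20.
  apply: (graded_laurent (Z := fun m q => tmap (Y q) idfun \o Y m)
    (gvc_grading HV) Hv').
    move=> r m q w /(Ygr m) Yw; rewrite -[- q]addr0.
    by apply: tmap_gr Yw => i u ui; rewrite ?addr0 //; apply: Ygr.
  by exists NY => m q mN; rewrite /= YN // linear0.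
have S12L : laurent_xVy S12.
  apply: (graded_laurent
    (Z := fun m q => tassoc V V V \o tmap idfun (Y q) \o Y m)
    (gvc_grading HV) Hv').
    by move=> r m q w /Rgr; apply.
  by exists NY => m q mN; rewrite /= YN // !linear0.
have S12'L : laurent_xVy S12'.
  apply: (graded_laurent (Z := fun m q => tmap (twist V V) idfun \o
      (tassoc V V V \o tmap idfun (Y q) \o Y m)) (gvc_grading HV) Hv').
    move=> r m q w /(Rgr m q); rewrite -[r - m - q in X in _ -> X]addr0.
    rewrite -[0 in X in _ -> X]addr0; apply: tmap_gr => i u; rewrite addr0 //.
    exact: twist_gr.
  by exists NY => m q mN; rewrite /= YN // !linear0.
have [N1 N1P] := laurent_nat S20L; have [N2 N2P] := laurent_nat S12L.
have [N3 N3P] := laurent_nat S12'L.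
pose N := (N1 + N2 + N3 + `|NY|)%N.
have NYN n : N%:Z < n -> Y n v = 0 by move=> Nn; apply: YN; rewrite /N in Nn; lia.
have RN : forall m q : int, (N%:Z < m) || (q < - N%:Z) -> S12 (m, q) = 0.
  by apply: N2P; rewrite /N; lia.
have WN : forall m q : int, (N%:Z < m) || (q < - N%:Z) -> S12' (m, q) = 0.
  by apply: N3P; rewrite /N; lia.
have LN : forall m q : int, (N%:Z < m) || (q < - N%:Z) -> S20 (m, q) = 0.
  by apply: N1P; rewrite /N; lia.
move: (N) NYN RN WN LN => {N}{}N NYN RN WN LN.
(* The order matters below: the last factor, x1 ^ N, is the one that weak
   associativity uses. *)
pose ls12 : seq (F * F) := nseq N (0, 1) ++ nseq N (1, -1) ++ nseq N (1, 0).
pose ls20 := [seq subst_form l | l <- ls12].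
have ls12_0 : (0, 0) \notin ls12.
  rewrite !mem_cat !mem_nseq !xpair_eqE ![0 == 1]eq_sym oner_eq0 /=.
  by rewrite !andbF.
have ls20_0 : (0, 0) \notin ls20 by apply: subst_form_neq0.
have [p S12p] : exists p, lacts ls12 S12 = poly_series p.
  exact: (right_denominators charF0 vcY NYN RN WN LN).
pose p' := polysub ('X + 'Y) 'X p.
have S20p' : lacts ls20 S20 = poly_series p'.
  apply: (@subst_expansion_uniq _ (lacts ls12 S12)); last first.
    by rewrite S12p; apply: subst_expansion_poly.
  rewrite /ls20 /ls12 catA map_cat (lacts_cat _ _ S12) (lacts_cat _ _ S20).
  apply: subst_expansion_lacts => //; first exact/bnd_lacts/laurent_bnd.
  rewrite map_nseq /subst_form /= addr0.
  exact: (weak_associativity charF0 vcY NYN WN).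
pose f := p%:F / (\prod_(l <- ls12) linform l)%:F.
pose k := p'%:F / (\prod_(l <- ls20) linform l)%:F.
have fS : ratS f by exists p, ls12.
have kS : ratS k by exists p', ls20.
have S12f : S12 = iota_ij f.
  by rewrite iota_ijE //; apply: expand_of_lacts => //; apply: laurent_bnd.
have S20k : S20 = iota_ij k.
  by rewrite iota_ijE //; apply: expand_of_lacts => //; apply: laurent_bnd.
split; [split=> //; exists k; split=> // | split; first by exists f].
- by move=> k' k'S S20k'; apply: (iota_ij_inj charF0) => //; rewrite -S20k.
- move=> x2 x0; exists p', N%:Z, N%:Z, N%:Z; rewrite /k.
  have -> : \prod_(l <- ls20) linform l = x0 ^+ N * x2 ^+ N * (x0 + x2) ^+ N.
    rewrite /ls20 !map_cat !map_nseq !big_cat !big_nseq /= !iter_mulr_1.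
    rewrite /subst_form /= add0r subrr addr0 linform_X linform_Y.
    by rewrite /linform /= !mul1r [x0 + x2]addrC mulrA [x0 ^+ N * _]mulrC.
  by rewrite !rmorphM !rmorphXn.
rewrite S12f S20k !iota_invK // subx0E ?linforms_neq0 //.
by rewrite /p' -polysub_linforms !polysub_x1K.
Qed.
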